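(* Let $m\ge2$ and $i\in\{1,\dots,m-1\}$. Let $A$ be a graded $\Bbbk$-algebra generated in degree $1$ by $u$ and $v$, carrying a grading-preserving $\mathcal{B}_{4m}$-module algebra structure with $A_1=\Bbbk u\oplus\Bbbk v=\pi_i(u,v)$. Then the action of $\mathcal{B}_{4m}$ on $A$ is inner-faithful if and only if $(i,2m)=1$.
   Context: Ground field $\Bbbk=\mathbb{C}$. An action of a Hopf algebra $H$ on an $H$-module algebra $A$ is inner-faithful if the only Hopf ideal $I$ of $H$ with $I\cdot A=0$ is $I=0$. $\mathcal{B}_{4m}$ (Masuoka), $m\ge2$: generated by $a,s_+,s_-$ with $a$ central and grouplike, $a^2=1$, $s_\pm^2=1$, $(s_+s_-)^m=a$. With $e_0=(1+a)/2$, $e_1=(1-a)/2$: $\Delta(s_\pm)=s_\pm\otimes e_0s_\pm+s_\mp\otimes e_1s_\pm$, $\epsilon(s_\pm)=1$, $S(s_\pm)=e_0s_\pm+e_1s_\mp$. It has dimension $4m$. With $\lambda=e^{\pi\sqrt{-1}/m}$, $\pi_i(u,v)$ is the two-dimensional module with ordered basis $u,v$ and $s_+u=v$, $s_+v=u$, $s_-u=\lambda^iv$, $s_-v=\lambda^{-i}u$, $a$ acting by $(-1)^i$. *)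

(* Defs.v *)
From HB Require Import structures.
From mathcomp Require Import all_boot all_order all_algebra all_field.
From mathcomp Require Import complex.
From mathcomp Require Import all_classical all_reals all_analysis.

Set Implicit Arguments.
Unset Strict Implicit.
Unset Printing Implicit Defensive.
Import GRing.Theory.
Local Open Scope ring_scope.

(* U (x) V is modelled by the matrices of coordinates in the products of the
   chosen basis vectors of U and V: the pure tensor x (x) y is the matrix of
   the products of the coordinates of x and y. *)
Section Tensor.
Variables (k : fieldType) (U V : vectType k).

Definition tensor := 'M[k]_(\dim {:U}, \dim {:V}).

Definition tens (x : U) (y : V) : tensor :=
  \matrix_(i, j) (coord (vbasis {:U}) i x * coord (vbasis {:V}) j y).

(* The linear map on U (x) V induced by a bilinear map f; in Sweedler notation
   tens_lift f (Delta h) is f h_(1) h_(2). See tens_liftE below. *)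
Definition tens_lift (W : lmodType k) (f : U -> V -> W) (t : tensor) : W :=
  \sum_i \sum_j t i j *: f (vbasis {:U})`_i (vbasis {:V})`_j.

(* The image of X (x) Y in U (x) V. *)
Definition tensv (X : {vspace U}) (Y : {vspace V}) : {vspace tensor} :=
  <<[seq tens x y | x <- vbasis X, y <- vbasis Y]>>%VS.

Lemma tens_lift_is_linear (W : lmodType k) (f : U -> V -> W) :
  linear (tens_lift f).
Proof.
move=> c s t; rewrite /tens_lift scaler_sumr -big_split; apply: eq_bigr => i _.
rewrite scaler_sumr -big_split; apply: eq_bigr => j _.
by rewrite !mxE scalerDl scalerA.
Qed.

Lemma tens_liftE (W : lmodType k) (f : U -> V -> W) :
  (forall y, linear (f^~ y)) -> (forall x, linear (f x)) ->
  forall x y, tens_lift f (tens x y) = f x y.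
Proof.
move=> fl fr x y.
pose gl y' : {linear U -> W} := HB.pack (f^~ y') (GRing.isLinear.Build _ _ _ _ _ (fl y')).
pose gr x' : {linear V -> W} := HB.pack (f x') (GRing.isLinear.Build _ _ _ _ _ (fr x')).
have -> : f x y = gl y x by [].
rewrite {2}(coord_vbasis (memvf x)) linear_sum; apply: eq_bigr => i _.
rewrite linearZ /= -[f _ y]/(gr (vbasis {:U})`_i y).
rewrite {2}(coord_vbasis (memvf y)) linear_sum scaler_sumr.
by apply: eq_bigr => j _; rewrite linearZ /= scalerA mxE.
Qed.

End Tensor.

(* The product of the tensor product of two algebras, here H (x) H:
   (x (x) y) (x' (x) y') = x x' (x) y y'. *)
Definition tens_mul (k : fieldType) (H : falgType k)
    (s t : tensor H H) : tensor H H :=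
  tens_lift (fun x y => tens_lift (fun x' y' => tens (x * x') (y * y')) t) s.

Record hopf_algebra (k : fieldType) (H : falgType k) := HopfAlgebra {
  comul : {linear H -> tensor H H};
  counit : {linear H -> k^o};
  antipode : {linear H -> H};
  comul1 : comul 1 = tens 1 1;
  comulM : forall x y, comul (x * y) = tens_mul (comul x) (comul y);
  counit1 : counit 1 = 1;
  counitM : forall x y, counit (x * y) = counit x * counit y;
  (* the reassociated h_(1)(1) (x) (h_(1)(2) (x) h_(2)) equals
     h_(1) (x) (h_(2)(1) (x) h_(2)(2)) in H (x) (H (x) H) *)
  comulA : forall h : H,
    tens_lift
      (fun x z => tens_lift (fun x1 x2 => tens x1 (tens x2 z)) (comul x))
      (comul h)
    = tens_lift (fun x y => tens x (comul y)) (comul h);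
  counitl : forall h : H, tens_lift (fun x y => counit x *: y) (comul h) = h;
  counitr : forall h : H, tens_lift (fun x y => counit y *: x) (comul h) = h;
  antipodel : forall h : H,
    tens_lift (fun x y => antipode x * y) (comul h) = counit h *: 1;
  antipoder : forall h : H,
    tens_lift (fun x y => x * antipode y) (comul h) = counit h *: 1
}.

Section Notions.
Variable k : fieldType.

Definition hopf_ideal (H : falgType k) (Hs : hopf_algebra H)
    (I : {vspace H}) : Prop :=
  [/\ forall h x, x \in I -> h * x \in I /\ x * h \in I,
      forall x, x \in I ->
        comul Hs x \in (tensv I fullv + tensv fullv I)%VS,
      forall x, x \in I -> counit Hs x = 0
    & forall x, x \in I -> antipode Hs x \in I].

Record module_algebra (H : falgType k) (Hs : hopf_algebra H)
    (A : algType k) (act : H -> A -> A) : Prop := {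
  act_linearl : forall x, linear (act^~ x);
  act_linearr : forall h, linear (act h);
  act1 : forall x, act 1 x = x;
  actM : forall g h x, act (g * h) x = act g (act h x);
  act_alg1 : forall h, act h 1 = counit Hs h *: 1;
  act_algM : forall h x y,
    act h (x * y) = tens_lift (fun h1 h2 => act h1 x * act h2 y) (comul Hs h)
}.

Definition inner_faithful (H : falgType k) (Hs : hopf_algebra H)
    (A : algType k) (act : H -> A -> A) : Prop :=
  forall I : {vspace H}, hopf_ideal Hs I ->
    (forall h x, h \in I -> act h x = 0) -> I = 0%VS.

Definition generates (A : algType k) (X : seq A) : Prop :=
  forall S : {pred A}, GRing.subalg_closed S -> {subset X <= S} ->
    forall x, x \in S.

(* A is the internal direct sum of the A_ n, n in nat. *)
Record grading (A : algType k) (A_ : nat -> {pred A}) : Prop := {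
  grading_submod : forall n, GRing.submod_closed (A_ n);
  grading1 : 1 \in A_ 0%N;
  gradingM : forall p q x y, x \in A_ p -> y \in A_ q -> x * y \in A_ (p + q)%N;
  grading_sum : forall x, exists n (f : nat -> A),
    (forall j, f j \in A_ j) /\ x = \sum_(j < n) f j;
  grading_direct : forall n (f : nat -> A), (forall j, f j \in A_ j) ->
    \sum_(j < n) f j = 0 -> forall j, (j < n)%N -> f j = 0
}.

(* u, v is a basis of the subspace X. *)
Definition basis2 (A : lmodType k) (X : {pred A}) (u v : A) : Prop :=
  (forall x, x \in X <-> exists c d : k, x = c *: u + d *: v) /\
  (forall c d : k, c *: u + d *: v = 0 -> c = 0 /\ d = 0).

Definition B4m_relations (m : nat) (K : algType k) (a sp sm : K) : Prop :=
  [/\ GRing.comm a sp /\ GRing.comm a sm,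
      a ^+ 2 = 1, sp ^+ 2 = 1, sm ^+ 2 = 1 & (sp * sm) ^+ m = a].

(* As an algebra, K is presented by the generators a, sp, sm and the relations
   above. *)
Record B4m_presentation (m : nat) (K : algType k) (a sp sm : K) : Prop := {
  B4m_rel : B4m_relations m a sp sm;
  B4m_gen : generates [:: a; sp; sm];
  B4m_univ : forall (L : algType k) (a' sp' sm' : L),
    B4m_relations m a' sp' sm' ->
    exists f : {lrmorphism K -> L}, [/\ f a = a', f sp = sp' & f sm = sm']
}.

Record is_B4m (m : nat) (H : falgType k) (Hs : hopf_algebra H)
    (a sp sm : H) : Prop := {
  B4m_alg : B4m_presentation m a sp sm;
  B4m_comul_a : comul Hs a = tens a a;
  B4m_counit_a : counit Hs a = 1;
  B4m_comul_s :
    let e0 := (2%:R : k)^-1 *: (1 + a) in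
    let e1 := (2%:R : k)^-1 *: (1 - a) in
    comul Hs sp = tens sp (e0 * sp) + tens sm (e1 * sp) /\
    comul Hs sm = tens sm (e0 * sm) + tens sp (e1 * sm);
  B4m_counit_s : counit Hs sp = 1 /\ counit Hs sm = 1;
  B4m_antipode_s :
    let e0 := (2%:R : k)^-1 *: (1 + a) in
    let e1 := (2%:R : k)^-1 *: (1 - a) in
    antipode Hs sp = e0 * sp + e1 * sm /\
    antipode Hs sm = e0 * sm + e1 * sp
}.

End Notions.

(* e^(pi sqrt(-1) / m) *)
Definition lambda (R : realType) (m : nat) : R[i] :=
  Complex (cos (pi / m%:R)) (sin (pi / m%:R)).

Definition acts_as_pi (R : realType) (m i : nat) (H A : lmodType R[i])
    (act : H -> A -> A) (a sp sm : H) (u v : A) : Prop :=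
  [/\ act sp u = v /\ act sp v = u,
      act sm u = lambda R m ^+ i *: v /\ act sm v = lambda R m ^- i *: u
    & act a u = (-1) ^+ i *: u /\ act a v = (-1) ^+ i *: v].

(* Main.v *)
From HB Require Import structures.
Require Import Defs.
From mathcomp Require Import all_boot all_order all_algebra all_field.
From mathcomp Require Import complex.
From mathcomp Require Import all_classical all_reals all_analysis.

Set Implicit Arguments.
Unset Strict Implicit.
Unset Printing Implicit Defensive.
Import Order.TTheory GRing.Theory Num.Theory.
Local Open Scope ring_scope.

(** As an algebra, B_4m is the group algebra of the dihedral group of order 4m
    with reflections s+, s- and rotation x = s+ s-, so that x^m = a. Write
    q = lambda^i; then x acts on u by q and on v by q^-1, and q is a primitive
    2m-th root of unity exactly when (i, 2m) = 1.

    The coproduct is governed by pairs (g, g') with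
    Delta g = g (x) e0 g + g' (x) e1 g, called twins below. The unit and the two
    generators s+, s- have twins, and twins multiply (twinM) because e0 and e1
    are orthogonal central idempotents. So each element x^j, s+ x^j of the
    spanning set (dihedral_span) has a twin: x'^j and s- x'^j, for
    x' = s- s+ = x^-1.

    Suppose (i, 2m) = 1, and let I be a Hopf ideal killing A. Since
    Delta I lies in I (x) B + B (x) I, contracting the first leg of Delta h with
    a matrix coefficient of the module A_1 sends I into I. Let f and f' be the
    coefficients that read the diagonal entries at u and at v. Then
      D h = e0 f(h_1) h_2 + e1 f'(h_1) h_2
    preserves I, multiplies x^j by q^j and kills every s+ x^j
    (rot_weight_operator). Given h = sum_j (c_j x^j + d_j s+ x^j) in I, applying
    the counit to the iterates of D at h gives sum_j c_j q^(je) = 0 for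
    all e > 0. A polynomial of degree less than 2m vanishing at all the 2m
    powers of q is zero, so all c_j vanish; the same argument for s+ h shows
    that all d_j vanish (hopf_ideal_trivial).

    Suppose (i, 2m) = d > 1, and put n = 2m / d, so that x^n acts trivially on u
    and v. The ideal B (x^n - 1) is a Hopf ideal (rot_ideal_hopf), the antipode
    being computed on twins by antipode_twin. A Hopf ideal which kills the
    generators of A kills A (hopf_ideal_kills). Finally x^n - 1 is not zero, as
    one sees in the two-dimensional representation of B_4m where x has order
    exactly 2m (B4m_rot_neq1); so the action is not inner-faithful. *)

(** * Tensors as coordinate matrices *)

Section Tensors.
Variables (k : fieldType) (U V : vectType k).

Lemma tens_linearl (y : V) : linear (fun x : U => tens x y).
Proof.
by move=> c x x'; apply/matrixP=> i j; rewrite !mxE linearP /= mulrDl mulrA.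
Qed.

Lemma tens_linearr (x : U) : linear (fun y : V => tens x y).
Proof.
move=> c y y'; apply/matrixP=> i j; rewrite !mxE linearP /= mulrDr.
by rewrite mulrCA.
Qed.

HB.instance Definition _ (x : U) :=
  GRing.isLinear.Build k V (tensor U V) _ (tens x) (tens_linearr x).
HB.instance Definition _ (W : lmodType k) (f : U -> V -> W) :=
  GRing.isLinear.Build k (tensor U V) W _ (tens_lift f)
    (tens_lift_is_linear f).

Lemma mem_tensv (X : {vspace U}) (Y : {vspace V}) x y :
  x \in X -> y \in Y -> tens x y \in tensv X Y.
Proof.
move=> Xx Yy; rewrite (coord_vbasis Xx) (coord_vbasis Yy).
set w := \sum_(i < _) coord _ i y *: _.
pose L : {linear U -> tensor U V} :=
  HB.pack (fun x => tens x w) (GRing.isLinear.Build _ _ _ _ _ (tens_linearl w)).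
rewrite -[tens _ w]/(L _) linear_sum; apply: memv_suml => i _.
rewrite linearZ memvZ //= /w.
rewrite linear_sum; apply: memv_suml => j _.
rewrite linearZ /= memvZ //; apply: memv_span.
by apply: allpairs_f; apply: mem_nth; rewrite size_tuple.
Qed.

Lemma tensv_ind (X : {vspace U}) (Y : {vspace V}) (K : tensor U V -> Prop) :
    K 0 -> (forall c s t, K s -> K t -> K (c *: s + t)) ->
    (forall x y, x \in X -> y \in Y -> K (tens x y)) ->
  forall t, t \in tensv X Y -> K t.
Proof.
move=> K0 KL KT t; rewrite /tensv.
set s := [seq tens x y | x <- vbasis X, y <- vbasis Y] => st.
rewrite (coord_span (X := in_tuple s) st).
elim/big_ind: _ => // [p q Kp Kq|i _]; first by rewrite -[p]scale1r; apply: KL.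
rewrite -[_ *: _]addr0; apply: KL => //.
have /allpairsP[[x y] /= [Xx Yy ->]] : s`_i \in s by exact: mem_nth.
by apply: KT; apply: vbasis_mem.
Qed.

Definition bilin (W : lmodType k) (f : U -> V -> W) :=
  (forall y, linear (f^~ y)) /\ (forall x, linear (f x)).

Lemma tens_lift2 (W : lmodType k) (f : U -> V -> W) x y x' y' : bilin f ->
  tens_lift f (tens x y + tens x' y') = f x y + f x' y'.
Proof. by case=> fl fr; rewrite linearD /= !tens_liftE. Qed.

End Tensors.

Section Coideals.
Variables (k : fieldType) (H : falgType k).
Implicit Types (I : {vspace H}) (s t : tensor H H).

(** The image of I (x) H + H (x) I in H (x) H, which is where a coideal I must
    have its coproducts. *)
Definition coidv I : {vspace tensor H H} := (tensv I fullv + tensv fullv I)%VS.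

Lemma mem_coidv I (x y : H) : x \in I \/ y \in I -> tens x y \in coidv I.
Proof.
case=> Ixy; last by rewrite -[tens _ _]add0r memv_add ?mem0v ?mem_tensv ?memvf.
by rewrite -[tens _ _]addr0 memv_add ?mem0v ?mem_tensv ?memvf.
Qed.

(** Every use of the coideal condition below is through this principle: a
    bilinear expression in h_(1), h_(2) is controlled on I as soon as it is when
    one of its two arguments lies in I. *)
Lemma coidv_ind I (K : tensor H H -> Prop) :
    K 0 -> (forall c s t, K s -> K t -> K (c *: s + t)) ->
    (forall x y, x \in I \/ y \in I -> K (tens x y)) ->
  forall t, t \in coidv I -> K t.
Proof.
move=> K0 KL KT _ /memv_addP[s sI [t tI ->]].
rewrite -[s]scale1r; apply: (KL).
  by apply: (tensv_ind K0 KL _ sI) => x y Ix _; apply: KT; left.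
by apply: (tensv_ind K0 KL _ tI) => x y _ Iy; apply: KT; right.
Qed.

Lemma bilin_tens (g h : H) : bilin (fun x y => tens (g * x) (h * y)).
Proof.
split=> z c x y; first by rewrite mulrDr -scalerAr tens_linearl.
by rewrite mulrDr -scalerAr linearP.
Qed.

Lemma tens_mul_is_linear s : linear (tens_mul s).
Proof.
move=> c t t'; pose g t x y :=
  tens_lift (fun x' y' : H => tens (x * x') (y * y')) t.
have gP x y : g (c *: t + t') x y = c *: g t x y + g t' x y by exact: linearP.
rewrite -[LHS]/(\sum_i \sum_j s i j *: g (c *: t + t') _ _).
rewrite -[tens_mul s t]/(\sum_i \sum_j s i j *: g t _ _).
rewrite -[tens_mul s t']/(\sum_i \sum_j s i j *: g t' _ _).
rewrite scaler_sumr -big_split; apply: eq_bigr => i _ /=.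
rewrite scaler_sumr -big_split; apply: eq_bigr => j _ /=.
by rewrite gP scalerDr !scalerA [_ * c]mulrC.
Qed.

HB.instance Definition _ s :=
  GRing.isLinear.Build k _ _ _ (tens_mul s) (tens_mul_is_linear s).

Lemma tens_mulDl s s' t : tens_mul (s + s') t = tens_mul s t + tens_mul s' t.
Proof. exact: raddfD. Qed.

Lemma tens_mulDr s t t' : tens_mul s (t + t') = tens_mul s t + tens_mul s t'.
Proof. exact: raddfD. Qed.

Lemma tens_mulE (x y x' y' : H) :
  tens_mul (tens x y) (tens x' y') = tens (x * x') (y * y').
Proof.
have E g h : tens_lift (fun x' y' => tens (g * x') (h * y')) (tens x' y') =
             tens (g * x') (h * y').
  by case: (bilin_tens g h) => bl br; rewrite tens_liftE.
rewrite /tens_mul tens_liftE ?E // => z c g h; rewrite !E mulrDl -scalerAl.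
  exact: tens_linearl.
by rewrite linearP.
Qed.

Lemma coidv_mul I s t : (forall h x, x \in I -> h * x \in I) ->
  t \in coidv I -> tens_mul s t \in coidv I.
Proof.
move=> idI tI; apply: memv_suml => i _; apply: memv_suml => j _; apply: memvZ.
set L := tens_lift _.
apply: (coidv_ind (K := fun p => L p \in coidv I) _ _ _ tI).
- by rewrite /L linear0 mem0v.
- by move=> c p q pI qI; rewrite /L linearP memvD ?memvZ.
move=> x y Ixy; rewrite /L.
case: (bilin_tens (vbasis {:H})`_i (vbasis {:H})`_j) => bl br.
by rewrite tens_liftE //; apply: mem_coidv; case: Ixy => /idI; [left|right].
Qed.

End Coideals.

(** * Central idempotents, twins and the antipode *)

Lemma generates_ind (k : fieldType) (A : algType k) (X : seq A)
    (P : A -> Prop) : generates X ->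
    P 1 -> (forall c x y, P x -> P y -> P (c *: x + y)) ->
    (forall x y, P x -> P y -> P (x * y)) -> (forall x, x \in X -> P x) ->
  forall x, P x.
Proof.
move=> genX P1 PL PM PX x; apply/asboolP.
have := genX [pred z | `[< P z >]]; apply; last first.
  by move=> z Xz; apply/asboolP; apply: PX.
split=> [|c y z|y z]; first exact/asboolP.
  by move=> /asboolP Py /asboolP Pz; apply/asboolP; apply: PL.
by move=> /asboolP Py /asboolP Pz; apply/asboolP; apply: PM.
Qed.

Section Masuoka.
Variables (k : fieldType) (m : nat) (H : falgType k) (Hs : hopf_algebra H).
Variables (a sp sm : H).
Hypothesis two_neq0 : (2%:R : k) != 0.
Hypothesis hB : is_B4m m Hs a sp sm.

Let e0 : H := (2%:R : k)^-1 *: (1 + a).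
Let e1 : H := (2%:R : k)^-1 *: (1 - a).
Let x := sp * sm.
Let x' := sm * sp.

Lemma comm_a h : a * h = h * a.
Proof.
case: (B4m_rel (B4m_alg hB)) => -[asp asm] a2 sp2 sm2 xm.
apply: (generates_ind (B4m_gen (B4m_alg hB)) (P := fun h => a * h = h * a)).
- by rewrite mulr1 mul1r.
- by move=> c y z ay az; rewrite mulrDr mulrDl -scalerAr -scalerAl ay az.
- by move=> y z ay az; rewrite -[RHS]mulrA -az !mulrA ay.
by move=> z; rewrite !inE => /or3P[] /eqP->.
Qed.

Lemma comm_e0 h : e0 * h = h * e0.
Proof. by rewrite -scalerAl -scalerAr mulrDl mulrDr comm_a mulr1 mul1r. Qed.

Lemma comm_e1 h : e1 * h = h * e1.
Proof. by rewrite -scalerAl -scalerAr mulrBl mulrBr comm_a mulr1 mul1r. Qed.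

Lemma a_sqr : a * a = 1.
Proof. by case: (B4m_rel (B4m_alg hB)). Qed.

Lemma e01 : e0 + e1 = 1.
Proof.
rewrite -scalerDr addrACA subrr addr0 -mulr2n -scaler_nat scalerA.
by rewrite mulVf // scale1r.
Qed.

Lemma e0e1 : e0 * e1 = 0.
Proof.
rewrite -scalerAl -scalerAr mulrBr mulr1 mulrDl mul1r a_sqr [a + 1]addrC.
by rewrite subrr !scaler0.
Qed.

Lemma e0e0 : e0 * e0 = e0.
Proof. by rewrite -[RHS]mulr1 -e01 mulrDr e0e1 addr0. Qed.

Lemma e1e1 : e1 * e1 = e1.
Proof. by rewrite -[RHS]mulr1 -e01 mulrDr comm_e1 e0e1 add0r. Qed.

(** The grouplike law Delta g = g (x) g, twisted: the first leg turns into g'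
    against the e1 part of the second. *)
Definition twin (g g' : H) :=
  comul Hs g = tens g (e0 * g) + tens g' (e1 * g).

Lemma twin1 : twin 1 1.
Proof. by rewrite /twin comul1 !mulr1 -raddfD e01. Qed.

(** The cross terms of Delta g * Delta h contain e0 e1 = 0 in the second leg. *)
Lemma twinM g g' h h' : twin g g' -> twin h h' -> twin (g * h) (g' * h').
Proof.
rewrite /twin comulM => -> ->.
rewrite tens_mulDl !tens_mulDr !tens_mulE.
have E (e f p q : H) : GRing.comm f p -> (e * p) * (f * q) = (e * f) * (p * q).
  by move=> fp; rewrite -!mulrA; congr (e * _); rewrite !mulrA fp.
rewrite (E e0 e0); last exact: comm_e0.
rewrite (E e0 e1); last exact: comm_e1.
rewrite (E e1 e0); last exact: comm_e0.
rewrite (E e1 e1); last exact: comm_e1.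
by rewrite e0e0 e1e1 [e1 * e0]comm_e1 e0e1 !mul0r !linear0 addr0 add0r.
Qed.

Lemma twinX g g' n : twin g g' -> twin (g ^+ n) (g' ^+ n).
Proof.
move=> tw; elim: n => [|n IH]; first by rewrite !expr0; apply: twin1.
by rewrite !exprS; apply: twinM.
Qed.

Lemma twin_sp : twin sp sm /\ twin sm sp.
Proof. exact: B4m_comul_s hB. Qed.

Lemma twin_x : twin x x' /\ twin x' x.
Proof. by case: twin_sp => tp tm; split; apply: twinM. Qed.

(** The two antipode identities S(h_1) h_2 = eps(h) for g and g' read
    (S(g) e0 + S(g') e1) g = 1 and (S(g') e0 + S(g) e1) g' = 1. Cancelling g and
    g' on the right and keeping the e0 part of the first equation and the e1
    part of the second leaves S(g). *)
Lemma antipode_twin g g' r r' : twin g g' -> twin g' g ->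
    counit Hs g = 1 -> counit Hs g' = 1 -> g * r = 1 -> g' * r' = 1 ->
  antipode Hs g = r * e0 + r' * e1.
Proof.
move=> tg tg' cg cg' gr gr'.
have S0 : bilin (fun y z : H => antipode Hs y * z).
  split=> u c y z; first by rewrite linearP mulrDl scalerAl.
  by rewrite mulrDr scalerAr.
have := antipodel Hs g; have := antipodel Hs g'.
rewrite tg tg' !(tens_lift2 _ _ _ _ S0) cg cg' !scale1r => E' E.
have {}E : antipode Hs g * e0 + antipode Hs g' * e1 = r.
  by rewrite -[RHS]mul1r -E mulrDl -!mulrA gr !mulr1.
have {}E' : antipode Hs g' * e0 + antipode Hs g * e1 = r'.
  by rewrite -[RHS]mul1r -E' mulrDl -!mulrA gr' !mulr1.
rewrite -E -E' !mulrDl -!mulrA e0e0 e1e1 e0e1 comm_e1 e0e1 !mulr0.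
by rewrite addr0 add0r -mulrDr e01 mulr1.
Qed.

(** * The dihedral spanning set *)

Lemma x'x : x' * x = 1.
Proof.
case: (B4m_rel (B4m_alg hB)) => _ _ sp2 sm2 _.
by rewrite /x' /x mulrA -(mulrA sm) -expr2 sp2 mulr1 -expr2 sm2.
Qed.

Lemma xx' : x * x' = 1.
Proof.
case: (B4m_rel (B4m_alg hB)) => _ _ sp2 sm2 _.
by rewrite /x' /x mulrA -(mulrA sp) -expr2 sm2 mulr1 -expr2 sp2.
Qed.

Lemma x'Xx n : x' ^+ n * x ^+ n = 1.
Proof.
elim: n => [|n IH]; first by rewrite !expr0 mulr1.
by rewrite exprSr exprS mulrA -(mulrA _ x') x'x mulr1.
Qed.

Lemma xXx' n : x ^+ n * x' ^+ n = 1.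
Proof.
elim: n => [|n IH]; first by rewrite !expr0 mulr1.
by rewrite exprSr exprS mulrA -(mulrA _ x) xx' mulr1.
Qed.

Lemma x_order : x ^+ (2 * m) = 1.
Proof.
case: (B4m_rel (B4m_alg hB)) => _ _ _ _ xm.
by rewrite mulnC exprM xm expr2 a_sqr.
Qed.

Lemma xX_swap (s : H) n : s = sp \/ s = sm -> x ^+ n * s = s * x' ^+ n.
Proof.
case: (B4m_rel (B4m_alg hB)) => _ _ sp2 sm2 _ ss.
have xs : x * s = s * x'.
  case: ss => ->; rewrite /x /x' ?mulrA //.
  by rewrite -[LHS]mulrA -(expr2 sm) sm2 mulr1 mul1r.
elim: n => [|n IH]; first by rewrite !expr0 mulr1 mul1r.
by rewrite exprSr -mulrA xs mulrA IH exprSr mulrA.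
Qed.

Hypothesis m_gt0 : (0 < m)%N.

(** The span U of the x^j and s+ x^j contains 1 and is stable under left
    multiplication by the generators, because s- = s+ x and x s+ = s+ x^-1; the
    elements h with h U inside U form a subalgebra, which is therefore
    everything. *)
Lemma dihedral_span h : exists c d : 'I_(2 * m) -> k,
  h = \sum_j (c j *: x ^+ j + d j *: (sp * x ^+ j)).
Proof.
have m2_gt0 : (0 < 2 * m)%N by rewrite muln_gt0.
pose U : {vspace H} :=
  (\sum_(j < 2 * m) (<[x ^+ j]> + <[sp * x ^+ j]>))%VS.
have xU n : x ^+ n \in U /\ sp * x ^+ n \in U.
  rewrite -(expr_mod n x_order); set j := Ordinal (ltn_pmod n m2_gt0).
  have jU : (<[x ^+ j]> + <[sp * x ^+ j]> <= U)%VS by exact: (sumv_sup j).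
  split; apply: (subvP jU).
    exact/(subvP (addvSl _ _))/memv_line.
  exact/(subvP (addvSr _ _))/memv_line.
have UP b : b \in U -> exists c d : 'I_(2 * m) -> k,
    b = \sum_j (c j *: x ^+ j + d j *: (sp * x ^+ j)).
  case/memv_sumP=> f fP ->.
  have /choice[cd cdP] j : exists cd : k * k,
      f j = cd.1 *: x ^+ j + cd.2 *: (sp * x ^+ j).
    have /memv_addP[_ /vlineP[c ->] [_ /vlineP[d ->] ->]] := fP j isT.
    by exists (c, d).
  exists (fst \o cd), (snd \o cd); apply: eq_bigr => j _; exact: cdP.
apply: (UP); rewrite -[h]mulr1; move: (xU 0%N) => [+ _]; rewrite expr0.
move: 1; case: (B4m_rel (B4m_alg hB)) => _ _ sp2 sm2 xm.
have Usp b : b \in U -> sp * b \in U.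
  case/UP=> c [d ->]; rewrite mulr_sumr memv_suml // => j _.
  rewrite mulrDr -!scalerAr mulrA -expr2 sp2 mul1r.
  by rewrite memvD ?memvZ //; case: (xU j).
have x'E : x' = x ^+ (2 * m).-1.
  rewrite -[LHS]mul1r -x_order -[in LHS](prednK m2_gt0) exprSr -mulrA.
  by rewrite xx' mulr1.
have xsp : x * sp = sp * x' by have := xX_swap 1 (or_introl erefl).
have Ux b : b \in U -> x * b \in U.
  case/UP=> c [d ->]; rewrite mulr_sumr memv_suml // => j _.
  rewrite mulrDr -!scalerAr -exprS mulrA xsp x'E -mulrA -exprD.
  by rewrite memvD ?memvZ //; apply xU.
apply: (generates_ind (B4m_gen (B4m_alg hB))
          (P := fun h => forall b, b \in U -> h * b \in U)).
- by move=> b; rewrite mul1r.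
- by move=> c y z yU zU b bU; rewrite mulrDl -scalerAl memvD ?memvZ ?yU ?zU.
- by move=> y z yU zU b bU; rewrite -mulrA yU ?zU.
move=> z; rewrite !inE => /or3P[] /eqP-> // b bU.
  rewrite -xm -/x; elim: m => [|n IH]; first by rewrite expr0 mul1r.
  by rewrite exprS -mulrA Ux.
rewrite -[sm]mul1r -sp2 expr2 -(mulrA sp) -/x -mulrA; exact/Usp/Ux.
Qed.

Lemma counit_x n : counit Hs (x ^+ n) = 1 /\ counit Hs (x' ^+ n) = 1.
Proof.
have [cp cm] := B4m_counit_s hB.
elim: n => [|n [IH IH']]; first by rewrite !expr0 counit1.
by rewrite !exprS !counitM IH IH' cp cm !mulr1.
Qed.

Lemma dihedral_twin (j : nat) (g : H) : g = x ^+ j \/ g = sp * x ^+ j ->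
  exists g' r r', [/\ twin g g' /\ twin g' g,
    counit Hs g = 1 /\ counit Hs g' = 1, g * r = 1 & g' * r' = 1].
Proof.
have [tx tx'] := twin_x; have [tp tm] := twin_sp.
have [cx cx'] := counit_x j; have [cp cm] := B4m_counit_s hB.
case: (B4m_rel (B4m_alg hB)) => _ _ sp2 sm2 _.
case=> ->.
  exists (x' ^+ j), (x' ^+ j), (x ^+ j).
  by split; rewrite ?xXx' ?x'Xx //; split=> //; apply: twinX.
exists (sm * x' ^+ j), (x' ^+ j * sp), (x ^+ j * sm).
split; first by split; apply: twinM => //; apply: twinX.
- by rewrite !counitM cp cm cx cx' mulr1.
- by rewrite mulrA -(mulrA sp) xXx' mulr1 -expr2.
by rewrite mulrA -(mulrA sm) x'Xx mulr1 -expr2.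
Qed.

(** * The Hopf ideal generated by a power of the rotation *)

Definition rot_ideal n : {vspace H} := limg (amulr (x ^+ n - 1)).

Lemma rot_idealP n h :
  reflect (exists g, h = g * (x ^+ n - 1)) (h \in rot_ideal n).
Proof.
apply: (iffP memv_imgP) => [[g _ ->]|[g ->]]; exists g; rewrite ?memvf //.
  by rewrite lfunE.
by rewrite lfunE.
Qed.

Lemma rot_idealMl n g h : h \in rot_ideal n -> g * h \in rot_ideal n.
Proof.
by case/rot_idealP=> f ->; apply/rot_idealP; exists (g * f); rewrite mulrA.
Qed.

Lemma rot_ideal_rot n : x ^+ n - 1 \in rot_ideal n.
Proof. by apply/rot_idealP; exists 1; rewrite mul1r. Qed.

Lemma rot_ideal_rot' n : x' ^+ n - 1 \in rot_ideal n.
Proof.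
apply/rot_idealP; exists (- x' ^+ n).
by rewrite mulrBr mulr1 mulNr x'Xx opprK addrC.
Qed.

(** The left ideal generated by x^n - 1 is two-sided since a generator s+ or s-
    moves across it at the cost of replacing x by x^-1, and x^-n - 1 is the
    multiple -x^-n (x^n - 1). *)
Lemma rot_idealMr n g h : h \in rot_ideal n -> h * g \in rot_ideal n.
Proof.
case/rot_idealP=> f ->; rewrite -mulrA; apply: rot_idealMl.
set y := x ^+ n - 1; set I := rot_ideal n.
have ys s : s = sp \/ s = sm -> y * s \in I.
  move=> ss; rewrite mulrBl xX_swap // mul1r -[X in _ - X]mulr1 -mulrBr.
  exact/rot_idealMl/rot_ideal_rot'.
apply: (generates_ind (B4m_gen (B4m_alg hB)) (P := fun g => y * g \in I)).
- by rewrite mulr1 rot_ideal_rot.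
- by move=> c p q pI qI; rewrite mulrDr -scalerAr memvD ?memvZ.
- move=> p q /rot_idealP[p' pE] qI.
  by rewrite mulrA pE -mulrA; apply: rot_idealMl.
move=> s; rewrite !inE => /or3P[] /eqP->; last first.
- by apply: ys; right.
- by apply: ys; left.
by rewrite -comm_a; apply: rot_idealMl; apply: rot_ideal_rot.
Qed.

(** Modulo I both x^n and x^-n become 1, so that
    Delta (x^n - 1) becomes 1 (x) (e0 + e1) - 1 (x) 1 = 0. *)
Lemma rot_ideal_comul n h : h \in rot_ideal n ->
  comul Hs h \in coidv (rot_ideal n).
Proof.
case/rot_idealP=> g ->; rewrite comulM.
apply: coidv_mul; first exact: rot_idealMl.
set I := rot_ideal n.
have [tx _] := twin_x; rewrite raddfB /= comul1 (twinX n tx) /=.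
have yI := rot_ideal_rot n; have y'I := rot_ideal_rot' n.
have split_tens (p q : H) : tens p q = tens (p - 1) q + tens 1 q.
  by have /= := tens_linearl q 1 (p - 1) 1; rewrite !scale1r subrK.
rewrite (split_tens (x ^+ n)) (split_tens (x' ^+ n)) addrACA.
rewrite -[X in _ + X - _](raddfD (tens 1)) /= -mulrDl e01 mul1r.
rewrite -addrA -(raddfB (tens 1)) /=.
by rewrite !memvD //; apply: mem_coidv; [left|left|right].
Qed.

(** For twins g, g' with inverses r, r', antipode_twin applied to g x^n and to
    g gives S(g (x^n - 1)) = (x^-n - 1) r e0 + (x^n - 1) r' e1. *)
Lemma rot_ideal_antipode n h : h \in rot_ideal n ->
  antipode Hs h \in rot_ideal n.
Proof.
case/rot_idealP=> f ->; set y := x ^+ n - 1; set I := rot_ideal n.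
have [tx tx'] := twin_x; have [cx cx'] := counit_x n.
have key j g : g = x ^+ j \/ g = sp * x ^+ j -> antipode Hs (g * y) \in I.
  case/dihedral_twin=> g' [r [r' [[tg tg'] [cg cg'] gr gr']]].
  rewrite mulrBr mulr1 raddfB /= (antipode_twin tg tg' cg cg' gr gr').
  rewrite (@antipode_twin _ (g' * x' ^+ n) (x' ^+ n * r) (x ^+ n * r')).
  - rewrite -!mulrA opprD addrACA.
    rewrite -{2}[r * _]mul1r -{2}[r' * _]mul1r -!mulrBl.
    by rewrite memvD // rot_idealMr // (rot_ideal_rot, rot_ideal_rot').
  - by apply: twinM => //; apply: twinX.
  - by apply: twinM => //; apply: twinX.
  - by rewrite counitM cg cx mulr1.
  - by rewrite counitM cg' cx' mulr1.
  - by rewrite mulrA -(mulrA g) xXx' mulr1.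
  by rewrite mulrA -(mulrA g') x'Xx mulr1.
have [c [d ->]] := dihedral_span f.
rewrite mulr_suml raddf_sum memv_suml // => j _.
rewrite mulrDl -!scalerAl raddfD /= !linearZ /=.
by rewrite memvD ?memvZ // (key j) //; [left|right].
Qed.

Lemma rot_ideal_hopf n : hopf_ideal Hs (rot_ideal n).
Proof.
split.
- by move=> g h hI; split; [apply: rot_idealMl|apply: rot_idealMr].
- exact: rot_ideal_comul.
- move=> _ /rot_idealP[g ->]; rewrite counitM raddfB /= counit1.
  by have [-> _] := counit_x n; rewrite subrr mulr0.
exact: rot_ideal_antipode.
Qed.

End Masuoka.

(** * Contracting coproducts with matrix coefficients *)

(** Injectivity of the discrete Fourier transform: the polynomial with
    coefficients c_j has degree less than n and vanishes at all the n powers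
    of q. *)
Lemma prim_root_sums_eq0 (k : fieldType) (n : nat) (q : k) (c : 'I_n -> k) :
    n.-primitive_root q ->
    (forall e, (0 < e)%N -> \sum_j c j * q ^+ (j * e) = 0) ->
  forall j, c j = 0.
Proof.
move=> qP cq l; pose P := \sum_j c j *: 'X^j : {poly k}.
suff P0 : P = 0.
  have := coef0 k l; rewrite -P0 coef_sum (bigD1 l) //= coefZ coefXn eqxx mulr1.
  rewrite big1 ?addr0 // => j jl; rewrite coefZ coefXn.
  by rewrite eq_sym -[_ == _ :> nat]/(j == l) (negPf jl) mulr0.
have cq0 e : \sum_j c j * q ^+ (j * e) = 0.
  (* the exponent 0 may be replaced by n, as q ^+ n = 1 *)
  case: e => [|e]; last exact: cq.
  rewrite -[RHS](cq n (prim_order_gt0 qP)); apply: eq_bigr => j _.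
  by rewrite muln0 mulnC exprM (prim_expr_order qP) expr1n expr0.
apply: (@roots_geq_poly_eq0 _ _ [seq q ^+ e | e <- iota 0 n]).
- apply/allP=> _ /mapP[e _ ->]; rewrite /root; apply/eqP.
  rewrite horner_sum -[RHS](cq0 e); apply: eq_bigr => j _.
  by rewrite hornerZ hornerXn exprAC exprM.
- rewrite map_inj_in_uniq ?iota_uniq // => e f; rewrite !mem_iota !add0n.
  move=> /andP[_ ltem] /andP[_ ltfm] /eqP; rewrite (eq_prim_root_expr qP).
  by rewrite !modn_small // => /eqP.
rewrite size_map size_iota (leq_trans (size_sum _ _ _)) //.
apply/bigmax_leqP=> j _; rewrite (leq_trans (size_scale_leq _ _)) //.
by rewrite size_polyXn.
Qed.

Lemma free2_inj (k : fieldType) (V : lmodType k) (u v : V) :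
    (forall c d : k, c *: u + d *: v = 0 -> c = 0 /\ d = 0) ->
  forall c d c' d' : k,
    c *: u + d *: v = c' *: u + d' *: v -> c = c' /\ d = d'.
Proof.
move=> uv0 c d c' d' /eqP; rewrite -subr_eq0 opprD addrACA -!scalerBl.
by move=> /eqP/uv0[/eqP cc /eqP dd]; split; apply/eqP; rewrite -subr_eq0.
Qed.

Section HopfIdeals.
Variables (k : fieldType) (H : falgType k) (Hs : hopf_algebra H).
Variables (A : algType k) (act : H -> A -> A).
Hypothesis hact : module_algebra Hs act.

(** The coideal condition makes the common kernel of I a subalgebra of A: I
    kills 1 through the counit, and kills a product because in each term of
    h_(1) x * h_(2) y one of the two factors vanishes. *)
Lemma hopf_ideal_kills (I : {vspace H}) (X : seq A) :
    hopf_ideal Hs I -> generates X ->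
    (forall z, z \in X -> forall h, h \in I -> act h z = 0) ->
  forall h z, h \in I -> act h z = 0.
Proof.
case=> _ Icom Icu _ genX IX h z; move: h.
apply: (generates_ind genX
          (P := fun z => forall h, h \in I -> act h z = 0)) => //.
- by move=> h hI; rewrite (act_alg1 hact) Icu // scale0r.
- move=> c y y' yK y'K h hI; rewrite (act_linearr hact) yK // y'K //.
  by rewrite scaler0 addr0.
move=> y y' yK y'K h hI; rewrite (act_algM hact).
have actB : bilin (fun g g' : H => act g y * act g' y').
  split=> g' c g f.
    by rewrite (act_linearl hact) mulrDl scalerAl.
  by rewrite (act_linearl hact) mulrDr scalerAr.
set L := tens_lift _.
apply: (coidv_ind (K := fun t => L t = 0) _ _ _ (Icom h hI)).
- exact: linear0.
- by move=> c s t s0 t0; rewrite /L linearP /= -/L s0 t0 scaler0 addr0.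
move=> f g fg; rewrite /L; case: actB => bl br; rewrite tens_liftE //.
by case: fg => [/yK->|/y'K->]; rewrite ?mul0r ?mulr0.
Qed.

(** The coordinates of h w on u, v are the matrix coefficients of the
    representation. *)
Lemma act_coords (u v w : A) :
    (forall c d : k, c *: u + d *: v = 0 -> c = 0 /\ d = 0) ->
    (forall h, exists c d : k, act h w = c *: u + d *: v) ->
  exists f g : {linear H -> k^o}, forall h, act h w = f h *: u + g h *: v.
Proof.
move=> uv0 hw.
have /choice[cd cdP] h : exists cd : k * k, act h w = cd.1 *: u + cd.2 *: v.
  by have [c [d E]] := hw h; exists (c, d).
have uvI := free2_inj uv0.
have cdL c h g : (cd (c *: h + g)).1 = c * (cd h).1 + (cd g).1 /\
                 (cd (c *: h + g)).2 = c * (cd h).2 + (cd g).2.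
  apply: uvI; rewrite -cdP (act_linearl hact) !cdP scalerDr !scalerA !scalerDl.
  by rewrite addrACA.
pose F : {linear H -> k^o} := HB.pack (fun h => (cd h).1 : k^o)
  (GRing.isLinear.Build k H k^o _ (fun h => (cd h).1)
     (fun c h g => (cdL c h g).1)).
pose G : {linear H -> k^o} := HB.pack (fun h => (cd h).2 : k^o)
  (GRing.isLinear.Build k H k^o _ (fun h => (cd h).2)
     (fun c h g => (cdL c h g).2)).
by exists F, G.
Qed.

(** The right action h |-> f(h_1) h_2 of the dual algebra on H. *)
Definition coact (f : {linear H -> k^o}) (h : H) : H :=
  tens_lift (fun y z => f y *: z) (comul Hs h).

Lemma coact_is_linear f : linear (coact f).
Proof. by move=> c h g; rewrite /coact !linearP. Qed.

HB.instance Definition _ f :=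
  GRing.isLinear.Build k H H _ (coact f) (coact_is_linear f).

Lemma bilin_coact (f : {linear H -> k^o}) : bilin (fun y z : H => f y *: z).
Proof.
split=> z c g h; first by rewrite linearP scalerDl scalerA.
by rewrite scalerDr !scalerA mulrC.
Qed.

(** If f vanishes on I, then f(h_1) h_2 only retains the terms of Delta h whose
    second leg is in I. This produces new elements of I from a given one. *)
Lemma hopf_ideal_coact (I : {vspace H}) (f : {linear H -> k^o}) h :
    hopf_ideal Hs I -> (forall g, g \in I -> f g = 0) -> h \in I ->
  coact f h \in I.
Proof.
case=> _ Icom _ _ f0 /Icom hI; rewrite /coact; set L := tens_lift _.
apply: (coidv_ind (K := fun t => L t \in I) _ _ _ hI).
- by rewrite /L linear0 mem0v.
- by move=> c s t sI tI; rewrite /L linearP memvD ?memvZ.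
move=> y z yz; rewrite /L; case: (bilin_coact f) => bl br.
rewrite tens_liftE //.
by case: yz => [/f0-> | zI]; [rewrite scale0r mem0v|rewrite memvZ].
Qed.

End HopfIdeals.

(** * Triviality of Hopf ideals when x has order 2m on the module *)

Section Faithful.
Variables (k : fieldType) (m : nat) (H : falgType k) (Hs : hopf_algebra H).
Variables (a sp sm : H).
Hypothesis two_neq0 : (2%:R : k) != 0.
Hypothesis m_gt0 : (0 < m)%N.
Hypothesis hB : is_B4m m Hs a sp sm.
Variables (A : algType k) (act : H -> A -> A) (u v : A) (q : k).
Hypothesis hact : module_algebra Hs act.
Hypothesis uv_free : forall c d : k, c *: u + d *: v = 0 -> c = 0 /\ d = 0.
Hypothesis act_sp : act sp u = v /\ act sp v = u.
Hypothesis act_sm : act sm u = q *: v /\ act sm v = q^-1 *: u.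

Let e0 : H := (2%:R : k)^-1 *: (1 + a).
Let e1 : H := (2%:R : k)^-1 *: (1 - a).
Let x := sp * sm.
Let x' := sm * sp.

Lemma actZ h c z : act h (c *: z) = c *: act h z.
Proof.
have h0 : act h 0 = 0.
  by have := act_linearr hact h (-1) 0 0; rewrite scaler0 addr0 scaleN1r addNr.
by have := act_linearr hact h c z 0; rewrite !addr0 h0 addr0.
Qed.

Lemma act_rot (n : nat) :
  [/\ act (x ^+ n) u = q ^+ n *: u, act (x ^+ n) v = q ^- n *: v,
      act (x' ^+ n) u = q ^- n *: u & act (x' ^+ n) v = q ^+ n *: v].
Proof.
have [[pu pv] [mu mv]] := (act_sp, act_sm).
have actX h c z : act h z = c *: z -> act (h ^+ n) z = c ^+ n *: z.
  move=> hz; elim: n => [|j IH]; first by rewrite !expr0 (act1 hact) scale1r.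
  by rewrite exprSr (actM hact) hz actZ IH scalerA -exprS.
by split; rewrite -?exprVn; apply: actX; rewrite (actM hact) ?mu ?mv ?pu ?pv
  ?actZ ?mu ?mv ?pu ?pv.
Qed.

Lemma act_span h : (exists c d : k, act h u = c *: u + d *: v) /\
                   (exists c d : k, act h v = c *: u + d *: v).
Proof.
have [[pu pv] [mu mv]] := (act_sp, act_sm).
suff actW w : (exists c d : k, w = c *: u + d *: v) ->
    exists c d : k, act h w = c *: u + d *: v.
  by split; apply: actW; [exists 1, 0|exists 0, 1];
    rewrite scale1r scale0r ?addr0 ?add0r.
have actL g c d : act g (c *: u + d *: v) = c *: act g u + d *: act g v.
  by rewrite (act_linearr hact) actZ.
have [_ _ _ _ xm] := B4m_rel (B4m_alg hB).
move: w; apply: (generates_ind (B4m_gen (B4m_alg hB)) (P := fun h => forall w,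
  (exists c d : k, w = c *: u + d *: v) ->
  exists c d : k, act h w = c *: u + d *: v)).
- by move=> w; rewrite (act1 hact).
- move=> c f g fW gW w wW.
  have [[c1 [d1 E1]] [c2 [d2 E2]]] := (fW w wW, gW w wW).
  exists (c * c1 + c2), (c * d1 + d2).
  rewrite (act_linearl hact) E1 E2 scalerDr !scalerA !scalerDl.
  by rewrite addrACA.
- by move=> f g fW gW w wW; rewrite (actM hact); apply/fW/gW.
move=> g; rewrite !inE => gX w [c [d ->]]; rewrite actL.
case/or3P: gX => /eqP->.
- have [au av _ _] := act_rot m; rewrite -xm au av !scalerA.
  by do 2 eexists.
- by rewrite pu pv addrC; do 2 eexists.
by rewrite mu mv !scalerA addrC; do 2 eexists.
Qed.

(** The operator D of the introduction. If (y, y') are twins and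
    f y = f' y' = c, then e0 picks f(y) e0 y and e1 picks f'(y') e1 y, so that
    D y = c y. On rotations f (x^j) = q^j = f' (x^-j); on reflections the
    diagonal coefficients f and f' vanish. Using f' instead of f on the e1 part
    undoes the exchange of x^j with x^-j in the coproduct. *)
Lemma rot_weight_operator : exists D : {linear H -> H},
  [/\ forall I : {vspace H}, hopf_ideal Hs I ->
        (forall h, h \in I -> act h u = 0 /\ act h v = 0) ->
        forall h, h \in I -> D h \in I,
      forall j : nat, D (x ^+ j) = q ^+ j *: x ^+ j
    & forall j : nat, D (sp * x ^+ j) = 0].
Proof.
have [[pu pv] [mu mv]] := (act_sp, act_sm).
have [f [g fgE]] := act_coords hact uv_free (fun h => (act_span h).1).
have [g' [f' gf'E]] := act_coords hact uv_free (fun h => (act_span h).2).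
have uvI := free2_inj uv_free.
have fE h c d : act h u = c *: u + d *: v -> f h = c.
  by rewrite fgE => /uvI[].
have f'E h c d : act h v = c *: u + d *: v -> f' h = d.
  by rewrite gf'E => /uvI[].
have f_rot j : f (x ^+ j) = q ^+ j.
  by apply: (fE _ _ 0); have [-> _ _ _] := act_rot j; rewrite scale0r addr0.
have f'_rot j : f' (x' ^+ j) = q ^+ j.
  by apply: (f'E _ 0); have [_ _ _ ->] := act_rot j; rewrite scale0r add0r.
have f_refl j : f (sp * x ^+ j) = 0.
  apply: (fE _ _ (q ^+ j)); rewrite (actM hact); have [-> _ _ _] := act_rot j.
  by rewrite actZ pu scale0r add0r.
have f'_refl j : f' (sm * x' ^+ j) = 0.
  apply: (f'E _ (q ^+ j * q^-1)); rewrite (actM hact).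
  by have [_ _ _ ->] := act_rot j; rewrite actZ mv scale0r addr0 scalerA.
pose T := coact Hs.
have TL : linear (fun h => e0 * T f h + e1 * T f' h).
  move=> c h h'; rewrite /T !linearP !mulrDr -!scalerAr addrACA.
  by rewrite scalerDr.
have Ttwin (y y' : H) : twin Hs a y y' -> f y = f' y' ->
    e0 * T f y + e1 * T f' y = f y *: y.
  move=> tw fy; rewrite /T /coact tw !tens_lift2; try exact: bilin_coact.
  rewrite !mulrDr -!scalerAr !mulrA (e0e0 two_neq0 hB) (e1e1 two_neq0 hB).
  rewrite (e0e1 hB) (comm_e1 hB) (e0e1 hB) !mul0r !scaler0 addr0 add0r -fy.
  by rewrite -scalerDr -mulrDl (e01 _ two_neq0) mul1r.
pose D : {linear H -> H} := HB.pack (fun h => e0 * T f h + e1 * T f' h)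
  (GRing.isLinear.Build _ _ _ _ _ TL).
exists D.
have [[tx _] [tp _]] := (twin_x two_neq0 hB, twin_sp hB).
have tX j := twinX two_neq0 hB j tx.
split=> [I hI Iuv h Ih|j|j] /=.
- have [Imul _ _ _] := hI.
  have f0 y : y \in I -> f y = 0.
    by case/Iuv=> y0 _; apply: (fE _ _ 0); rewrite y0 !scale0r addr0.
  have f'0 y : y \in I -> f' y = 0.
    by case/Iuv=> _ y0; apply: (f'E _ 0); rewrite y0 !scale0r addr0.
  by apply: memvD; apply: (Imul _ _ _).1; apply: hopf_ideal_coact.
- by rewrite (Ttwin _ _ (tX j)) f_rot // f'_rot.
rewrite (Ttwin _ _ (twinM two_neq0 hB tp (tX j))) f_refl ?f'_refl //.
by rewrite scale0r.
Qed.

Hypothesis q_prim : (2 * m).-primitive_root q.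

(** For h in I with rotation coefficients c_j, the counit of D^e h is the
    Fourier sum of the c_j q^(je), and it vanishes for all e > 0; so every c_j
    is zero. *)
Lemma hopf_ideal_trivial (I : {vspace H}) : hopf_ideal Hs I ->
    (forall h, h \in I -> act h u = 0 /\ act h v = 0) ->
  I = 0%VS.
Proof.
move=> hI Iuv; have [D [DI D_rot D_refl]] := rot_weight_operator.
have [Imul _ Icu _] := hI.
have rot_coef (c d : 'I_(2 * m) -> k) :
    \sum_j (c j *: x ^+ j + d j *: (sp * x ^+ j)) \in I -> forall j, c j = 0.
  move=> Ih; apply: (prim_root_sums_eq0 q_prim) => -[//|e] _.
  set h := \sum_j _ in Ih.
  have De : iter e.+1 D h = \sum_j (c j * q ^+ (j * e.+1)) *: x ^+ j.
    elim: e => [|e IH] /=.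
      rewrite raddf_sum; apply: eq_bigr => j _.
      by rewrite raddfD /= !linearZ /= D_rot D_refl scaler0 addr0 scalerA muln1.
    rewrite -iterS IH raddf_sum /=; apply: eq_bigr => j _.
    by rewrite linearZ /= D_rot scalerA -mulrA -exprD [in RHS]mulnS addnC.
  have /Icu : iter e.+1 D h \in I.
    by elim: e.+1 => //= n; apply: DI.
  rewrite De raddf_sum /= => E; rewrite -[RHS]E; apply: eq_bigr => j _.
  have [cx _] := counit_x hB j.
  have cZ b g : counit Hs (b *: g) = b * counit Hs g by exact: linearZ.
  by rewrite [RHS]cZ cx mulr1.
apply/eqP; rewrite -subv0; apply/subvP=> h Ih; rewrite memv0; apply/eqP.
have [c [d hE]] := dihedral_span hB m_gt0 h.
have [_ _ sp2 _ _] := B4m_rel (B4m_alg hB).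
have Ic := Ih; rewrite hE in Ic; have c0 := rot_coef c d Ic.
(* left multiplication by s+ exchanges the coefficients c and d *)
have d0 : forall j, d j = 0.
  have [Id _] := Imul sp h Ih; rewrite hE mulr_sumr in Id.
  refine (rot_coef d c _);
  rewrite (eq_bigr (fun j => sp * (c j *: x ^+ j + d j *: (sp * x ^+ j)))) //.
  move=> j _; rewrite mulrDr -!scalerAr [sp * (sp * _)]mulrA.
  by rewrite -(expr2 sp) sp2 mul1r addrC.
by rewrite hE big1 // => j _; rewrite c0 d0 !scale0r addr0.
Qed.

End Faithful.

(** * The order of the rotation, and the root of unity *)

(** The presentation maps K to 2 x 2 matrices by a |-> -1, with s+ and s- going
    to the antidiagonal matrices with entries (1, 1) and (q, q^-1). Their
    product is diag (q^-1, q), whose m-th power is -1 because q^m = -1. *)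
Lemma B4m_rot_neq1 (k : fieldType) (m : nat) (K : algType k) (a sp sm : K)
    (q : k) (n : nat) :
    B4m_presentation m a sp sm -> (0 < m)%N -> (2 * m).-primitive_root q ->
  (sp * sm) ^+ n = 1 -> (2 * m %| n)%N.
Proof.
move=> presK m_gt0 qP xn1.
have qm : q ^+ m = -1.
  have /eqP := prim_expr_order qP; rewrite mulnC exprM sqrf_eq1.
  case/orP=> /eqP //; move/eqP; rewrite -(prim_order_dvd qP) => /dvdn_leq.
  by move/(_ m_gt0); rewrite mul2n -addnn -{3}[m]addn0 leq_add2l leqNgt m_gt0.
have q0 : q != 0.
  apply/eqP=> q0; have /eqP := prim_expr_order qP.
  by rewrite q0 expr0n gtn_eqF ?muln_gt0 //= eq_sym oner_eq0.
(* s' and r are the antidiagonal and the diagonal matrices *)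
pose s' (c d : k) : 'M[k]_2 :=
  \matrix_(i, j) (if i == j then 0 else if i == 0 then c else d).
pose r (c d : k) : 'M[k]_2 :=
  \matrix_(i, j) (if i == j then if i == 0 then c else d else 0).
have ss c d c' d' : s' c d * s' c' d' = r (c * d') (d * c').
  apply/matrixP=> i j; rewrite !mxE !big_ord_recl big_ord0 !mxE.
  by case: i => [[|[]]] // ?; case: j => [[|[]]] // ?;
    rewrite /= ?mulr0 ?mul0r ?addr0 ?add0r.
have rX c d e : r c d ^+ e = r (c ^+ e) (d ^+ e).
  elim: e => [|e IH].
    by apply/matrixP=> i j; rewrite !expr0 !mxE if_same; case: (i == j).
  rewrite exprS IH; apply/matrixP=> i j.
  rewrite !mxE !big_ord_recl big_ord0 !mxE.
  by case: i => [[|[]]] // ?; case: j => [[|[]]] // ?;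
    rewrite /= ?mulr0 ?mul0r ?addr0 ?add0r ?exprS.
have r1 c : r c c = c%:M.
  by apply/matrixP=> i j; rewrite !mxE if_same; case: (i == j).
have rel : B4m_relations m (-1 : 'M[k]_2) (s' 1 1) (s' q q^-1).
  split.
  - by split; rewrite /GRing.comm mulrN1 mulN1r.
  - by rewrite sqrrN expr1n.
  - by rewrite expr2 ss mulr1 r1.
  - by rewrite expr2 ss mulfV // mulVf // r1.
  by rewrite ss !mul1r rX exprVn qm invrN1 r1 raddfN.
have [f [_ fp fm]] := B4m_univ presK rel.
have := congr1 f xn1; rewrite rmorphXn rmorphM rmorph1 /= fp fm ss !mul1r rX.
move/matrixP/(_ 1 1); rewrite !mxE /= => /eqP.
by rewrite -(prim_order_dvd qP).
Qed.

Section Lambda.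
Variable R : realType.

Lemma lambdaX (m n : nat) : lambda R m ^+ n =
  Complex (cos (pi / m%:R *+ n)) (sin (pi / m%:R *+ n)).
Proof.
elim: n => [|n IH]; first by rewrite expr0 mulr0n cos0 sin0.
by rewrite exprS IH mulrS cosD sinD [sin _ * cos _ + _]addrC.
Qed.

(** The order d of lambda divides 2m. It is not smaller than 2m, because
    sin (d pi / m) vanishes for 0 < d < 2m only at d = m, where the cosine
    is -1. *)
Lemma lambda_prim (m : nat) : (0 < m)%N -> (2 * m).-primitive_root (lambda R m).
Proof.
move=> m_gt0; have mR : m%:R != 0 :> R by rewrite pnatr_eq0 gtn_eqF.
have m2 : (0 < 2 * m)%N by rewrite muln_gt0.
have turn : pi / m%:R *+ m = pi :> R by rewrite -mulr_natr divfK.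
have l1 : lambda R m ^+ (2 * m) = 1.
  by rewrite lambdaX mulnC mulrnA turn cos2pi sin2pi.
have [d dP dm] := prim_order_exists m2 l1.
suff -> : (2 * m)%N = d by [].
have d_gt0 := prim_order_gt0 dP.
apply/eqP; rewrite eq_sym eqn_leq dvdn_leq //= leqNgt; apply/negP=> ltd.
have sin_neq0 n : (0 < n < m)%N -> sin (pi / m%:R *+ n : R) != 0.
  case/andP=> n0 nm; rewrite gt_eqF // sin_gt0_pi //; apply/andP; split.
    by rewrite pmulrn_lgt0 // divr_gt0 ?pi_gt0 // ltr0n.
  rewrite -[ltRHS]turn ltr_pMn2l //.
  by rewrite divr_gt0 ?pi_gt0 // ltr0n.
have := prim_expr_order dP; rewrite lambdaX => -[cd sd].
case: (ltngtP d m) => [dltm|mltd|dm'].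
- by have := sin_neq0 d; rewrite d_gt0 dltm sd eqxx => /(_ isT).
- have dE : d = (m + (d - m))%N by rewrite subnKC // ltnW.
  have := sin_neq0 (d - m)%N; move: sd; rewrite {1}dE mulrnDr turn addrC sinDpi.
  move=> /eqP; rewrite oppr_eq0 => ->; rewrite subn_gt0 mltd.
  by rewrite ltn_subLR ?(ltnW mltd) // addnn -mul2n ltd => /(_ isT).
move: cd; rewrite dm' turn cospi => /eqP.
by rewrite eq_sym -subr_eq0 opprK -mulr2n pnatr_eq0.
Qed.

End Lambda.

(** * Inner-faithfulness *)

Theorem theorem4p5 (R : realType) (m i : nat) (hm : (2 <= m)%N)
    (hi : (1 <= i <= m - 1)%N)
    (B : falgType R[i]) (Bs : hopf_algebra B) (a sp sm : B)
    (hB : is_B4m m Bs a sp sm)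
    (A : algType R[i]) (A_ : nat -> {pred A}) (hA : grading A_) (u v : A)
    (hgen : generates [:: u; v])
    (act : B -> A -> A) (hact : module_algebra Bs act)
    (hgr : forall n h x, x \in A_ n -> act h x \in A_ n)
    (hA1 : basis2 (A_ 1%N) u v)
    (hpi : acts_as_pi m i act a sp sm u v) :
  inner_faithful Bs act <-> coprime i (2 * m).
Proof.
have m_gt0 : (0 < m)%N := ltnW hm.
have lP := lambda_prim R m_gt0.
have two_neq0 : (2%:R : R[i]) != 0 by rewrite pnatr_eq0.
have [_ uv_free] := hA1; have [act_sp act_sm _] := hpi.
split=> [faithful|coim]; last first.
  move=> I hI IA.
  apply: (hopf_ideal_trivial two_neq0 m_gt0 hB hact uv_free act_sp act_sm _ hI).
    by rewrite prim_root_exp_coprime.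
  by move=> h Ih; rewrite !IA.
(* n is the order of q = lambda ^+ i, that is the order of x on u and v *)
pose n := (2 * m %/ gcdn i (2 * m))%N.
have qn : (lambda R m ^+ i) ^+ n = 1.
  exact: prim_expr_order (exp_prim_root lP i).
have [xu xv _ _] := act_rot hact act_sp act_sm n.
have rot0 : (sp * sm) ^+ n - 1 = 0.
  apply/eqP; rewrite -memv0.
  rewrite -(faithful (rot_ideal sp sm n) (rot_ideal_hopf two_neq0 hB m_gt0 n)).
    exact: rot_ideal_rot.
  apply: (hopf_ideal_kills hact (rot_ideal_hopf two_neq0 hB m_gt0 n) hgen).
  have rotE g z : act (g * ((sp * sm) ^+ n - 1)) z =
                  act g (act ((sp * sm) ^+ n) z - z).
    rewrite (actM hact); congr (act g _).
    have := act_linearl hact z (-1) 1 ((sp * sm) ^+ n).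
    by rewrite scaleN1r [-1 + _]addrC => ->; rewrite (act1 hact) scaleN1r addrC.
  have act0 g : act g 0 = 0 by have := actZ hact g 0 0; rewrite !scale0r.
  move=> z; rewrite !inE => /orP[] /eqP-> _ /rot_idealP[g ->]; rewrite rotE.
    by rewrite xu qn scale1r subrr act0.
  by rewrite xv qn invr1 scale1r subrr act0.
have := B4m_rot_neq1 (B4m_alg hB) m_gt0 lP (subr0_eq rot0).
have m2_gt0 : (0 < 2 * m)%N by rewrite muln_gt0.
have g_gt0 : (0 < gcdn i (2 * m))%N by rewrite gcdn_gt0 m2_gt0 orbT.
have n_gt0 : (0 < n)%N by rewrite divn_gt0 // dvdn_leq ?dvdn_gcdr.
move/dvdn_leq => /(_ n_gt0); rewrite leq_divRL ?dvdn_gcdr //.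
by move=> le1; rewrite /coprime eqn_leq g_gt0 andbT -(leq_pmul2l m2_gt0) muln1.
Qed.
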